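(* Consider a robust MDP $(\mathcal{S},\mathcal{A},\boldsymbol{r},\mathcal{U},\boldsymbol{p}_0)$ whose uncertainty set $\mathcal{U}$ is sa-rectangular and compact. Then the following strong duality results hold: $$\sup_{\pi\in\Pi_{\sf H}}\ \inf_{\boldsymbol{P}\in\mathcal{U}} R_{\sf avg}(\pi,\boldsymbol{P}) = \inf_{\boldsymbol{P}\in\mathcal{U}}\ \sup_{\pi\in\Pi_{\sf H}} R_{\sf avg}(\pi,\boldsymbol{P}),$$ $$\max_{\pi\in\Pi_{\sf SD}}\ \inf_{\boldsymbol{P}\in\mathcal{U}} R_{\sf avg}(\pi,\boldsymbol{P}) = \inf_{\boldsymbol{P}\in\mathcal{U}}\ \max_{\pi\in\Pi_{\sf SD}} R_{\sf avg}(\pi,\boldsymbol{P}).$$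
   Context: A robust MDP (RMDP) is a tuple $(\mathcal{S},\mathcal{A},\boldsymbol{r},\mathcal{U},\boldsymbol{p}_0)$: $\mathcal{S}$ (states) and $\mathcal{A}$ (actions) are finite nonempty sets, $\boldsymbol{r}\in\mathbb{R}^{\mathcal{S}\times\mathcal{A}\times\mathcal{S}}$ is the reward function, the uncertainty set $\mathcal{U}\subset\Delta(\mathcal{S})^{\mathcal{S}\times\mathcal{A}}$ is a nonempty compact set of transition probabilities $\boldsymbol{P}=(\boldsymbol{p}_{sa})_{s,a}$, and $\boldsymbol{p}_0\in\Delta(\mathcal{S})$ is the initial distribution; $\Delta(\mathcal{S})$ is the simplex of probability distributions on $\mathcal{S}$. The set $\mathcal{U}$ is sa-rectangular if $\mathcal{U}=\prod_{(s,a)\in\mathcal{S}\times\mathcal{A}}\mathcal{U}_{sa}$ with $\mathcal{U}_{sa}\subseteq\Delta(\mathcal{S})$. $\Pi_{\sf H}$ is the set of history-dependent, possibly randomized policies (the distribution of the action $a_t$ may depend on $(s_0,a_0,\dots,s_t)$); $\Pi_{\sf SD}\subset\Pi_{\sf H}$ is the (finite) set of stationary deterministic policies, i.e. maps $\mathcal{S}\to\mathcal{A}$. $\mathbb{E}_{\pi,\boldsymbol{P}}$ is expectation with respect to the law of $(s_t,a_t)_{t\ge0}$ induced by $\pi$ and $\boldsymbol{P}$. The average return is $$R_{\sf avg}(\pi,\boldsymbol{P})=\mathbb{E}_{\pi,\boldsymbol{P}}\Big[\limsup_{T\to+\infty}\tfrac{1}{T+1}\sum_{t=0}^{T} r_{s_ta_ts_{t+1}}\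 \Big|\ s_0\sim\boldsymbol{p}_0\Big].$$ *)

(* Defs.v *)
From HB Require Import structures.
From mathcomp Require Import all_boot all_order all_algebra.
From mathcomp Require Import all_classical all_reals all_analysis.

Set Implicit Arguments.
Unset Strict Implicit.
Unset Printing Implicit Defensive.

Import Order.TTheory GRing.Theory Num.Theory.
Import numFieldNormedType.Exports.

Local Open Scope classical_set_scope.
Local Open Scope ring_scope.

(* Nonempty finite types, given with a point because measurable types are
   pointed; no definition below depends on the choice of the point. *)
#[short(type="finPointedType")]
HB.structure Definition FinPointed := {T of Finite T & Pointed T}.

Definition simplex (R : realType) (T : finType) : set (T -> R) :=
  [set p | (forall x, 0 <= p x) /\ \sum_x p x = 1].
Arguments simplex : clear implicits.

Section trajectories.
Variables S A : finPointedType.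

Definition coordinate_sets : set (set (nat -> S * A)) :=
  [set C | exists t (B : set (S * A)), C = [set w | B (w t)]].

(* Omega = (S * A)^N with the product of the discrete sigma-algebras. *)
Definition trajectory := g_sigma_algebraType coordinate_sets.
HB.instance Definition _ := Measurable.on trajectory.

(* h_t = (s_0, a_0, ..., s_{t-1}, a_{t-1}) *)
Definition history (w : nat -> S * A) (t : nat) : seq (S * A) := mkseq w t.

End trajectories.
Arguments coordinate_sets : clear implicits.

Section mdp.
Variables (R : realType) (S A : finPointedType).

(* [pi h s a] is the probability of playing [a] after history [h] followed by
   the current state [s]. *)
Definition policy := seq (S * A) -> S -> A -> R.

Definition history_policies : set policy :=
  [set pi | forall h s, simplex R A (pi h s)].

(* The embedding of Pi_SD, the maps S -> A, into Pi_H. *)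
Definition sd_policy (d : {ffun S -> A}) : policy :=
  fun _ s a => (a == d s)%:R.

(* R^(S x A x S) with its product topology; [P (s, a) s'] is the probability of
   moving to [s'] after playing [a] in [s]. *)
Definition transitions := {ptws S * A -> {ptws S -> R}}.
HB.instance Definition _ := Topological.on transitions.

Definition sa_rectangular (U : set transitions) :=
  exists2 Usa : S -> A -> set (S -> R),
    (forall s a, Usa s a `<=` simplex R S) &
    U = [set P | forall s a, Usa s a (P (s, a))].

Variables (p0 : S -> R) (pi : policy) (P : transitions).

(* The conditional probability of (s_t, a_t) given h_t. *)
Definition step_prob (w : nat -> S * A) (t : nat) : R :=
  (if t is t'.+1 then P (w t') (w t).1 else p0 (w t).1)
  * pi (history w t) (w t).1 (w t).2.

(* [mu] is the law of (s_t, a_t)_t, characterized by its finite-dimensional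
   marginals. *)
Definition is_law (mu : probability (trajectory S A) R) :=
  forall (w : nat -> S * A) (n : nat),
    mu [set w' | forall t, (t < n)%N -> w' t = w t]
    = (\prod_(t < n) step_prob w t)%:E.

(* See [lawP] and [law_unique]. *)
Definition law : probability (trajectory S A) R := get is_law.

(* R_avg is an extended real because [limn_esup] and the integral are; its
   value is always finite. *)
Definition Ravg (r : S -> A -> S -> R) : \bar R :=
  (\int[law]_w limn_esup (fun T =>
    (T.+1%:R^-1 * \sum_(t < T.+1) r (w t).1 (w t).2 (w t.+1).1)%:E))%E.

End mdp.

Arguments history_policies : clear implicits.

(* Existence of the law: the process is simulated from a uniform variable [u] on
   [0, 1[ by splitting, after each history, the current interval in proportion
   to the conditional probabilities. Histories are reversed, the last element
   coming first. *)
Section simulation.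
Variables (R : realType) (X : finType) (x0 : X) (q : seq X -> X -> R).
Hypothesis q_simplex : forall h, simplex R X (q h).

Let cum (h : seq X) (k : nat) : R := \sum_(y | (enum_rank y < k)%N) q h y.

Fixpoint width (h : seq X) : R :=
  if h is x :: h' then width h' * q h' x else 1.

Fixpoint left_end (h : seq X) : R :=
  if h is x :: h' then left_end h' + width h' * cum h' (enum_rank x) else 0.

Definition cell (h : seq X) : set R := `[left_end h, left_end h + width h[.

Let q_ge0 h x : 0 <= q h x. Proof. by case: (q_simplex h). Qed.

Lemma width_ge0 h : 0 <= width h.
Proof. by elim: h => //= x h ih; rewrite mulr_ge0. Qed.

Let cumS h x : cum h (enum_rank x).+1 = cum h (enum_rank x) + q h x.
Proof.
rewrite /cum (bigD1 x) ?ltnS//= addrC; congr (_ + _); apply: eq_bigl => y.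
by rewrite ltnS [in RHS]ltn_neqAle andbC (inj_eq val_inj) (inj_eq enum_rank_inj).
Qed.

Let le_cum h (k l : nat) : (k <= l)%N -> cum h k <= cum h l.
Proof.
move=> kl; rewrite /cum [leRHS](bigID (fun y => (enum_rank y < k)%N))/=.
rewrite [X in _ <= X + _](_ : _ = cum h k).
  by rewrite lerDl sumr_ge0.
apply: eq_bigl => y; apply/andP/idP => [[]//|yk].
by split=> //; exact: leq_trans kl.
Qed.

Let cum0 h : cum h 0 = 0. Proof. exact: big_pred0. Qed.

Let cum1 h : cum h #|X| = 1.
Proof.
by case: (q_simplex h) => _ <-; apply: eq_bigl => y; rewrite ltn_ord.
Qed.

Let cell_cons x h u : cell (x :: h) u =
  (left_end h + width h * cum h (enum_rank x) <= u <
   left_end h + width h * cum h (enum_rank x).+1) :> Prop.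
Proof. by rewrite /cell /= in_itv/= cumS mulrDr addrA. Qed.

Let cell_sub x h : cell (x :: h) `<=` cell h.
Proof.
move=> u; rewrite cell_cons => /andP[lu ur].
rewrite /cell/= in_itv/=; apply/andP; split.
  by apply: le_trans lu; rewrite lerDl mulr_ge0 ?width_ge0 ?sumr_ge0.
apply: lt_le_trans ur _; rewrite lerD2l ler_piMr ?width_ge0//.
by rewrite -(cum1 h) le_cum.
Qed.

Lemma cell_sub01 h : cell h `<=` `[0, 1[.
Proof.
elim: h => [|x h ih]; first by rewrite /cell/= add0r.
by move=> u /cell_sub/ih.
Qed.

Let cell_inj h x y u : cell (x :: h) u -> cell (y :: h) u -> x = y.
Proof.
wlog xy : x y / (enum_rank x <= enum_rank y)%N.
  move=> H cx cy; case: (leqP (enum_rank x) (enum_rank y)) => [xy|/ltnW yx].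
    exact: H.
  by apply/esym; exact: H.
rewrite !cell_cons => /andP[_ ux] /andP[yu _]; apply: enum_rank_inj.
apply: val_inj; apply/eqP; rewrite eqn_leq xy/= leqNgt; apply/negP => ltxy.
have := le_lt_trans yu ux; rewrite ltNge => /negP; apply.
by rewrite lerD2l ler_wpM2l ?width_ge0// le_cum.
Qed.

Let cell_ex h u : cell h u -> exists x, cell (x :: h) u.
Proof.
rewrite {1}/cell/= in_itv/= => /andP[lu ur].
have ex : exists k, u < left_end h + width h * cum h k.
  by exists #|X|; rewrite cum1 mulr1.
case: (ex_minnP ex) => -[|k] uk kmin.
  by move: uk; rewrite cum0 mulr0 addr0 ltNge lu.
have kX : (k < #|X|)%N by apply: kmin; rewrite cum1 mulr1.
exists (enum_val (Ordinal kX)); rewrite cell_cons enum_valK uk andbT leNgt.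
by apply/negP => /kmin; rewrite ltnn.
Qed.

Let next u h : X := odflt x0 [pick x | `[< cell (x :: h) u >] ].

Let hist u n : seq X := iter n (fun h => next u h :: h) [::].

Definition simulate (u : R) (n : nat) : X :=
  if u \in `[0, 1[ then next u (hist u n) else x0.

Lemma simulateP u h : u \in `[0, 1[ ->
  (forall t, (t < size h)%N -> simulate u t = nth x0 (rev h) t) <-> cell h u.
Proof.
move=> u01.
have sz n : size (hist u n) = n by elim: n => //= n ->.
have nthH n t : (t < n)%N -> nth x0 (rev (hist u n)) t = simulate u t.
  elim: n => // n ih; rewrite ltnS leq_eqVlt /= rev_cons nth_rcons size_rev sz.
  by case/predU1P => [->|/[dup] tn ->]; [rewrite ltnn eqxx /simulate u01|exact: ih].
have cellH n : cell (hist u n) u.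
  elim: n => [|n /cell_ex[x xu]] /=; first by rewrite /cell/= add0r.
  rewrite /next; case: pickP => [y /asboolP//|/(_ x)/negP[]]; exact/asboolP.
have -> : (forall t, (t < size h)%N -> simulate u t = nth x0 (rev h) t)
    <-> hist u (size h) = h.
  split=> [hh|<- t]; last by rewrite sz => th; rewrite nthH.
  apply: (can_inj revK); apply: (@eq_from_nth _ x0) => [|t].
    by rewrite !size_rev sz.
  by rewrite size_rev sz => th; rewrite nthH// hh.
split=> [<-//|]; elim: h => //= x h ih xu.
have hh := ih (cell_sub xu); congr cons => //.
apply: (@cell_inj h _ _ u) => //.
by have := cellH (size h).+1; rewrite /= hh.
Qed.

End simulation.

Section law_theory.
Variables (R : realType) (S A : finPointedType).
Variables (p0 : S -> R) (pi : policy R S A) (P : transitions R S A).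

Let prefix_set (w : nat -> S * A) (n : nat) : set (trajectory S A) :=
  [set w' | forall t, (t < n)%N -> w' t = w t].

Let prefix_sets : set (set (trajectory S A)) :=
  [set C | C = set0 \/ exists w n, C = prefix_set w n].

Let measurable_coordinate t (B : set (S * A)) :
  measurable ([set w | B (w t)] : set (trajectory S A)).
Proof. by apply: sub_sigma_algebra; exists t, B. Qed.

Let measurable_prefix_set w n : measurable (prefix_set w n).
Proof.
elim: n => [|n ih].
  rewrite (_ : prefix_set w 0 = setT); first exact: measurableT.
  by apply/seteqP; split.
rewrite (_ : prefix_set w n.+1 = prefix_set w n `&` [set w' | w' n = w n]).
  by apply: measurableI => //; exact: (measurable_coordinate n [set w n]).
apply/seteqP; split=> [w' h|w' [h1 h2] t] /=.
  by split; [move=> t tn; apply: h; exact: ltnW|exact: h].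
by rewrite ltnS leq_eqVlt => /predU1P[->//|]; exact: h1.
Qed.

Let prefix_setsE :
  @measurable _ (trajectory S A) = <<s prefix_sets >>.
Proof.
apply/seteqP; split.
  apply: smallest_sub; first exact: smallest_sigma_algebra.
  move=> _ [t [B ->]].
  pose F (h : seq (S * A)) : set (trajectory S A) :=
    [set w | B (nth point h t) /\ mkseq w t.+1 = h].
  have -> : [set w | B (w t)] = \bigcup_h F h.
    apply/seteqP; split=> [w Bw|w [h _ [Bh wh]]] /=.
      by exists (mkseq w t.+1) => //; split => //; rewrite nth_mkseq.
    by move: Bh; rewrite -wh nth_mkseq.
  apply: (@countable_bigcupT_measurable _ (g_sigma_algebraType prefix_sets)).
    exact: countableP.
  move=> h; apply: sub_sigma_algebra.
  have [[Bh szh]|nBh] := pselect (B (nth point h t) /\ size h = t.+1); last first.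
    left; apply/seteqP; split=> // w [Bh wh]; apply: nBh; split=> //.
    by rewrite -wh size_mkseq.
  right; exists (nth point h), t.+1; apply/seteqP; split=> [w [_ wh] i it|w wh] /=.
    by rewrite -wh nth_mkseq.
  split=> //; apply: (@eq_from_nth _ point); first by rewrite size_mkseq.
  by move=> i; rewrite size_mkseq => it; rewrite nth_mkseq// wh.
apply: smallest_sub; first exact: sigma_algebra_measurable.
move=> _ [->|[w [n ->]]]; [exact: measurable0|exact: measurable_prefix_set].
Qed.

Let setI_prefix_sets : setI_closed prefix_sets.
Proof.
have nested w1 w2 n1 n2 : (n1 <= n2)%N ->
    prefix_sets (prefix_set w1 n1 `&` prefix_set w2 n2).
  move=> n12; have [h|h] := pselect (prefix_set w1 n1 w2); [right|left].
    exists w2, n2; apply/seteqP; split=> [w' []//|w' h2]; split=> // t tn.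
    by rewrite h2 ?h//; exact: leq_trans n12.
  apply/seteqP; split=> // w' [h1 h2]; apply: h => t tn.
  by rewrite -h1// h2//; exact: leq_trans n12.
move=> _ _ [->|[w1 [n1 ->]]] [->|[w2 [n2 ->]]].
- by left; rewrite setI0.
- by left; rewrite set0I.
- by left; rewrite setI0.
- case: (leqP n1 n2) => [|/ltnW] n12; first exact: nested.
  by rewrite setIC; exact: nested.
Qed.

Lemma law_unique (mu nu : probability (trajectory S A) R) :
  is_law p0 pi P mu -> is_law p0 pi P nu ->
  forall C, measurable C -> mu C = nu C.
Proof.
move=> hmu hnu; apply: (measure_unique prefix_sets (fun=> setT)) => //.
- move=> _; right; exists (fun=> point), 0; exact/seteqP.
- by apply/seteqP; split=> // w _; exists 0.
- by move=> _ [->|[w [n ->]]]; rewrite ?measure0// [LHS]hmu [RHS]hnu.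
- by move=> _; rewrite ltey_eq fin_num_measure.
Qed.

Hypothesis p0_simplex : simplex R S p0.
Hypothesis pi_policy : history_policies R S A pi.
Hypothesis P_simplex : forall sa, simplex R S (P sa).

Let q (h : seq (S * A)) (x : S * A) : R :=
  step_prob p0 pi P (nth point (rcons (rev h) x)) (size h).

Let q_simplex h : simplex R (S * A)%type (q h).
Proof.
pose m : S -> R := if h is x :: _ then P x else p0.
have m_simplex : simplex R S m by rewrite /m; case: (h).
have qE x : q h x = m x.1 * pi (rev h) x.1 x.2.
  have nx : nth point (rcons (rev h) x) (size h) = x.
    by rewrite nth_rcons size_rev ltnn eqxx.
  rewrite /q /step_prob nx; congr (_ * pi _ _ _); last first.
    apply: (@eq_from_nth _ point); first by rewrite size_mkseq size_rev.
    move=> i; rewrite size_mkseq => ih.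
    by rewrite nth_mkseq// nth_rcons size_rev ih.
  rewrite /m; case: (h) => [//|y h'] /=.
  by rewrite rev_cons !nth_rcons size_rcons size_rev ltnS leqnn ltnn eqxx.
split=> [x|].
  by rewrite qE mulr_ge0//; [case: m_simplex|case: (pi_policy (rev h) x.1)].
rewrite (eq_bigr _ (fun x _ => qE x)).
rewrite -(pair_big xpredT xpredT (fun s a => m s * pi (rev h) s a))/=.
case: m_simplex => _ <-; apply: eq_bigr => s _.
by rewrite -big_distrr/=; case: (pi_policy (rev h) s) => _ ->; rewrite mulr1.
Qed.

Let width_q w n : width q (rev (mkseq w n)) = \prod_(t < n) step_prob p0 pi P w t.
Proof.
elim: n => [|n ih]; first by rewrite big_ord0.
rewrite big_ord_recr/= -ih mkseqS rev_rcons/=; congr (_ * _).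
rewrite /q revK size_rev size_mkseq -mkseqS /step_prob !nth_mkseq//.
congr (_ * pi _ _ _).
  by case: n {ih} => [//|n]; rewrite nth_mkseq.
apply: (@eq_from_nth _ point); rewrite !size_mkseq// => i ni.
by rewrite !nth_mkseq// ltnW.
Qed.

Let unit_itv : set (measurableTypeR R) := `[0, 1[.

Let measurable_unit_itv : measurable unit_itv.
Proof. exact: measurable_itv. Qed.

Let sim : measurableTypeR R -> trajectory S A := simulate (point : S * A) q.

Let measurable_sim : measurable_fun setT sim.
Proof.
apply: (@measurability _ _ (measurableTypeR R) (trajectory S A) setT sim (coordinate_sets S A)) => [//|_ [_ [t [B ->]] <-]].
rewrite setTI.
pose F h : set (measurableTypeR R) :=
  if `[< B (nth point (rev h) t) >] && (size h == t.+1) then cell q h else set0.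
have -> : sim @^-1` [set w | B (w t)] =
    \bigcup_h F h `|` (~` unit_itv `&` [set _ | B point]).
  apply/seteqP; split=> [u /= Bu|u].
    have [u01|u01] := boolP (u \in (`[0, 1[ : interval R)); last first.
      by right; split; [exact/negP|move: Bu; rewrite /sim /simulate (negbTE u01)].
    left; exists (rev (mkseq (sim u) t.+1)) => //; rewrite /F revK nth_mkseq//.
    rewrite asboolT// size_rev size_mkseq eqxx/=.
    apply/(simulateP (point : S * A) q_simplex _ u01) => i.
    by rewrite size_rev size_mkseq revK => it; rewrite nth_mkseq.
  case=> [[h _]|[/= /negP u01 Bp]]; last by rewrite /sim /simulate (negbTE u01).
  rewrite /F; case: ifPn => // /andP[/asboolP Bh /eqP szh] hu /=.
  have u01 := cell_sub01 q_simplex hu.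
  move/(simulateP (point : S * A) q_simplex _ u01) : hu => /(_ t).
  by rewrite szh => hu; rewrite /sim hu.
apply: measurableU.
  apply: countable_bigcupT_measurable => [|h]; first exact: countableP.
  by rewrite /F; case: ifP => // _; exact: measurable_itv.
apply: measurableI; first exact: measurableC.
have [Bp|Bp] := pselect (B point).
  by rewrite (_ : [set _ | _] = setT)//; apply/seteqP; split.
by rewrite (_ : [set _ | _] = set0)//; apply/seteqP; split.
Qed.

Lemma lawP : is_law p0 pi P (law p0 pi P).
Proof.
apply: getPex.
pose m := mrestr (@lebesgue_measure R) measurable_unit_itv.
have m1 : m setT = 1%E.
  by rewrite /m /mrestr setTI lebesgue_measure_itv/= lte_fin ltr01 oppr0 adde0.
pose mP : probability (measurableTypeR R) R :=
  HB.pack m (Measure_isProbability.Build _ _ _ m m1).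
pose X : {mfun measurableTypeR R >-> trajectory S A} :=
  mfun_Sub (mem_set measurable_sim).
exists (distribution mP X : probability (trajectory S A) R) => w n; rewrite /distribution /pushforward /= /m /mrestr.
rewrite (_ : _ `&` unit_itv = cell q (rev (mkseq w n))).
  rewrite /cell lebesgue_measure_itv/= lte_fin ltrDl -width_q.
  case: ltgtP (width_ge0 q_simplex (rev (mkseq w n))) => // [_ _|<- _].
    by rewrite -EFinD addrAC subrr add0r.
  by [].
have uP u : u \in (`[0, 1[ : interval R) ->
    (forall t, (t < n)%N -> sim u t = w t) <-> cell q (rev (mkseq w n)) u.
  move=> u01; rewrite -(simulateP (point : S * A) q_simplex _ u01) revK size_rev size_mkseq.
  split=> h t tn; first by rewrite nth_mkseq//; exact: h.
  by rewrite -(nth_mkseq (point : S * A) w tn); exact: h.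
apply/seteqP; split=> [u [/= hu u01]|u hu]; first exact/(uP _ u01).
by have u01 := cell_sub01 q_simplex hu; split=> //; apply/uP.
Qed.

End law_theory.

(* Main.v *)
Require Import Defs.
From mathcomp Require Import all_boot all_order all_algebra.
From mathcomp Require Import all_classical all_reals all_analysis.
From mathcomp Require Import measurable_realfun.
From mathcomp Require Import ring lra.

Set Implicit Arguments.
Unset Strict Implicit.
Unset Printing Implicit Defensive.

Import Order.TTheory GRing.Theory Num.Theory.
Import numFieldNormedType.Exports.
Local Open Scope classical_set_scope.
Local Open Scope ring_scope.

(* Only finitely many points of [U] matter: if every stationary deterministic [d]
   has a kernel [P_d] in [U] keeping its return below a level [c], then by
   rectangularity the adversary may choose, in each state-action pair, a row of
   one of the [P_d], and one is left with a finite perfect-information game.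
   Along an ultrafilter, (approximate) discounted saddle points [(d, sigma)] with
   discount factors tending to 1 are constant, and the normalized values converge
   to some [g]; the discounted values themselves serve as potentials [f] in the
   approximate mean-payoff optimality inequalities
     [P g <= g] and [P (r + f) <= f + g + e].
   For an arbitrary history-dependent policy these inequalities bound the
   expected limsup average by [g] (and the reversed ones bound it from below):
   [g(s_t)] is a bounded supermartingale with finitely many values, so its total
   variation is integrable, and the exponential of a small multiple of
   [sum (r - g - 2 e)] decays geometrically in expectation. *)

(** * Discounted games and their mean-payoff limit *)

Section simplex_average.
Variables (R : realType) (T : finType) (p : T -> R).
Hypothesis p_simplex : simplex R T p.

Lemma ler_average (f g : T -> R) :
  (forall x, f x <= g x) -> \sum_x p x * f x <= \sum_x p x * g x.
Proof.
by case: p_simplex => p0 _ fg; apply: ler_sum => x _; rewrite ler_wpM2l.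
Qed.

Lemma average_cst (c : R) : \sum_x p x * c = c.
Proof. by case: p_simplex => _ p1; rewrite -mulr_suml p1 mul1r. Qed.

Lemma averageD (f g : T -> R) :
  \sum_x p x * (f x + g x) = \sum_x p x * f x + \sum_x p x * g x.
Proof. by rewrite -big_split; apply: eq_bigr => x _; rewrite mulrDr. Qed.

Lemma averageZ (c : R) (f : T -> R) :
  \sum_x p x * (c * f x) = c * \sum_x p x * f x.
Proof. by rewrite mulr_sumr; apply: eq_bigr => x _; rewrite mulrCA. Qed.

Lemma average_le (f : T -> R) c : (forall x, f x <= c) -> \sum_x p x * f x <= c.
Proof. by move=> fc; rewrite -[leRHS]average_cst; exact: ler_average. Qed.

Lemma average_ge (f : T -> R) c : (forall x, c <= f x) -> c <= \sum_x p x * f x.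
Proof. by move=> fc; rewrite -[leLHS]average_cst; exact: ler_average. Qed.

End simplex_average.

Lemma fin_bounded (R : realType) (T : finType) (f : T -> R) :
  exists2 M, 1 <= M & forall x, `|f x| <= M.
Proof.
exists (1 + \sum_x `|f x|) => [|x]; first by rewrite lerDl sumr_ge0.
rewrite (bigD1 x)//= addrCA lerDl addr_ge0// sumr_ge0//.
Qed.

Section discounted_game.
Variables (R : realType) (S A B : finType) (a0 : A) (b0 : B).
Variables (Q : B -> S * A -> S -> R) (r : S -> A -> S -> R).
Hypothesis Q_simplex : forall b sa, simplex R S (Q b sa).

Definition lookahead (l : R) (v : S -> R) b s a :=
  \sum_s' Q b (s, a) s' * (r s a s' + l * v s').

(** The minimizer moves after seeing the action: this is the perfect information that
    sa-rectangularity gives the adversary, and it makes pure moves optimal. *)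
Definition reply l v s a := [arg min_(b < b0) lookahead l v b s a]%O.

Definition greedy l v s := [arg max_(a > a0) lookahead l v (reply l v s a) s a]%O.

Definition shapley l v s :=
  lookahead l v (reply l v s (greedy l v s)) s (greedy l v s).

Lemma reply_le l v b s a :
  lookahead l v (reply l v s a) s a <= lookahead l v b s a.
Proof. by rewrite /reply; case: arg_minP => // i _; apply. Qed.

Lemma greedy_ge l v s a :
  lookahead l v (reply l v s a) s a <= shapley l v s.
Proof. by rewrite /shapley /greedy; case: arg_maxP => // i _; apply. Qed.

(** Test both sides on the greedy action for [v] and the reply to it for [w]. The one-sided form
    yields monotonicity and contraction at once. *)
Lemma shapley_contract (l : R) (v w : S -> R) c :
  0 <= l -> (forall s, v s <= w s + c) ->
  forall s, shapley l v s <= shapley l w s + l * c.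
Proof.
move=> l0 vwc s; pose a := greedy l v s; pose b := reply l w s a.
apply: le_trans (reply_le l v b s _) _.
apply: le_trans (_ : lookahead l w b s a + l * c <= _); last first.
  by rewrite lerD2r; exact: greedy_ge.
rewrite -[X in _ + X](average_cst (Q_simplex b (s, a))).
rewrite /lookahead -averageD; apply: ler_average => // s'.
by rewrite -addrA lerD2l -mulrDr ler_wpM2l.
Qed.

(** Value iteration from 0: consecutive iterates differ by at most [l ^+ k * M], so a late iterate
    has a small residual. *)
Lemma approx_fixpoint M l eta : 0 <= l < 1 -> 0 < eta ->
  0 <= M -> (forall s a s', `|r s a s'| <= M) ->
  exists v, (forall s, `|(1 - l) * v s| <= M) /\
            (forall s, `|shapley l v s - v s| <= eta).
Proof.
move=> /andP[l0 l1] eta0 M0 rM.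
pose v k : S -> R := iter k (shapley l) (fun=> 0).
have l10 : 0 < 1 - l by rewrite subr_gt0.
have T0 s : `|shapley l (fun=> 0) s| <= M.
  rewrite /shapley /lookahead ler_norml; apply/andP; split.
    apply: average_ge => // s'; rewrite mulr0 addr0.
    by have := rM s (greedy l (fun=> 0) s) s'; rewrite ler_norml => /andP[].
  apply: average_le => // s'; rewrite mulr0 addr0.
  by have := rM s (greedy l (fun=> 0) s) s'; rewrite ler_norml => /andP[].
have diff k s : `|v k.+1 s - v k s| <= l ^+ k * M.
  elim: k s => [|k ih] s; first by rewrite /v/= subr0 expr0 mul1r.
  rewrite exprS -mulrA ler_norml lerBlDr lerBrDr addrC; apply/andP; split.
    rewrite lerBlDr; apply: shapley_contract => // s'.
    by have := ih s'; rewrite distrC ler_norml => /andP[_]; rewrite lerBlDl.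
  rewrite addrC; apply: shapley_contract => // s'.
  by have := ih s'; rewrite ler_norml => /andP[_]; rewrite lerBlDl.
have bnd k s : `|(1 - l) * v k s| <= M.
  have -> : `|(1 - l) * v k s| <= M = (`|v k s| <= M / (1 - l)).
    by rewrite normrM (gtr0_norm l10) mulrC ler_pdivlMr.
  elim: k s => [|k ih] s.
    by rewrite /v/= normr0 divr_ge0// ltW.
  (* The radius [M / (1 - l)] is the fixed point of [x -> M + l * x], so one more iteration
     preserves the bound. *)
  have ME : M / (1 - l) = M + l * (M / (1 - l)).
    by field; rewrite gt_eqF.
  have := T0 s; rewrite !ler_norml ME => /andP[T0l T0r]; apply/andP; split.
    have := @shapley_contract l (fun=> 0) (v k) (M / (1 - l)) l0.
    have H s' : 0 <= v k s' + M / (1 - l).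
      by have := ih s'; rewrite ler_norml => /andP[+ _]; rewrite -subr_ge0 opprK.
    move=> /(_ H s); rewrite -[shapley l (v k) s]/(v k.+1 s); lra.
  have := @shapley_contract l (v k) (fun=> 0) (M / (1 - l)) l0.
  have H s' : v k s' <= 0 + M / (1 - l).
    by have := ih s'; rewrite ler_norml add0r => /andP[].
  move=> /(_ H s); rewrite -[shapley l (v k) s]/(v k.+1 s); lra.
have [k kM] : exists k, l ^+ k * M <= eta.
  have : (fun k => l ^+ k * M) @ \oo --> (0 * M).
    by apply: cvgM; [apply: cvg_expr; rewrite ger0_norm|exact: cvg_cst].
  rewrite mul0r => /cvgrPdist_le/(_ eta eta0)[k _ /(_ k (leqnn k))] /=.
  by rewrite sub0r normrN => h; exists k; exact: le_trans (ler_norm _) h.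
by exists (v k); split => // s; exact: le_trans (diff k s) kM.
Qed.

Lemma approx_saddle M l eta : 0 <= l < 1 -> 0 < eta ->
  0 <= M -> (forall s a s', `|r s a s'| <= M) ->
  exists z : (S -> R) * ({ffun S -> A} * {ffun S * A -> B}),
  [/\ forall s, `|(1 - l) * z.1 s| <= M,
      forall s a, lookahead l z.1 (z.2.2 (s, a)) s a <= z.1 s + eta &
      forall s b, z.1 s - eta <= lookahead l z.1 b s (z.2.1 s)].
Proof.
move=> l01 eta0 M0 rM; have [v [vM vT]] := approx_fixpoint l01 eta0 M0 rM.
exists (v, ([ffun s => greedy l v s], [ffun sa => reply l v sa.1 sa.2])).
split=> //= s a; rewrite ffunE/=; have := vT s; rewrite ler_norml => /andP[h1 h2].
  by apply: le_trans (greedy_ge l v s a) _; rewrite -lerBlDl.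
apply: le_trans (reply_le l v a s _).
rewrite -[leRHS]/(shapley l v s); lra.
Qed.

End discounted_game.

(** Compactness of [[- M, M]] gives a cluster point, and an ultrafilter converges to each of its
    cluster points. *)
Lemma ultra_bounded_cvg (R : realType) (T : Type) (F : set_system T)
    (u : T -> R) (M : R) :
  UltraFilter F -> (forall t, `|u t| <= M) -> exists x : R, u @ F --> x.
Proof.
move=> FU uM.
have uFM : (u @ F) `[- M, M]%classic.
  by apply: (@filterE _ F) => t; have := uM t; rewrite ler_norml /= in_itv.
have [x [_ xu]] := segment_compact (fmap_proper_filter u _) uFM.
exists x => V Vx; have [//|FV] := in_ultra_setVsetC (u @^-1` V) FU.
by have [y [/= yV Vy]] := xu (~` V) V FV Vx.
Qed.

Lemma ultra_finType (T : Type) (F : set_system T) (I : finType) (f : T -> I) :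
  UltraFilter F -> exists i, \near F, f F = i.
Proof.
move=> FU; apply: contrapT => /forallNP nf.
have : \near F, forall i, f F <> i.
  apply: filter_forall => i.
  by have [Fi|//] := in_ultra_setVsetC [set t | f t = i] FU; case: (nf i).
by move=> /filter_ex[t /(_ (f t))].
Qed.

Section finite_game.
Variables (R : realType) (S A B : finType) (a0 : A) (b0 : B).
Variables (Q : B -> S * A -> S -> R) (r : S -> A -> S -> R).
Hypothesis Q_simplex : forall b sa, simplex R S (Q b sa).

(* The discounted saddle points with discount factors tending to 1 are constant
   along an ultrafilter, and [g] is the limit along it of the normalized
   discounted values. *)
Lemma mean_payoff_saddle :
  exists (g : S -> R) (d : {ffun S -> A}) (sigma : {ffun S * A -> B}),
  [/\ forall s a, \sum_s' Q (sigma (s, a)) (s, a) s' * g s' <= g s,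
      forall s b, g s <= \sum_s' Q b (s, d s) s' * g s' &
      forall e, 0 < e -> exists f : S -> R,
      (forall s a, \sum_s' Q (sigma (s, a)) (s, a) s' * (r s a s' + f s')
                   <= f s + g s + e) /\
      (forall s b, f s + g s - e
                   <= \sum_s' Q b (s, d s) s' * (r s (d s) s' + f s'))].
Proof.
have [M M1 rM'] := fin_bounded (fun x : S * A * S => r x.1.1 x.1.2 x.2).
have {rM'}rM s a s' : `|r s a s'| <= M by exact: (rM' (s, a, s')).
have M0 : 0 <= M by apply: le_trans M1.
(* [e n] serves both as one minus the discount factor and as the accuracy of the saddle point. *)
pose e n : R := n.+1%:R^-1.
have e0 n : 0 < e n by rewrite invr_gt0.
have l01 n : 0 <= 1 - e n < 1.
  by rewrite ltrBlDr ltrDl e0 andbT subr_ge0 invf_le1// ler1n.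
have /choice[z zP] n := approx_saddle a0 b0 Q_simplex (l01 n) (e0 n) M0 rM.
have [F [FU oF]] := ultraFilterLemma (F := \oo) _.
have [[d sigma] Fds] := ultra_finType (fun n => (z n).2) FU.
pose u s n := e n * (z n).1 s.
have uM s n : `|u s n| <= M.
  by case: (zP n) => + _ _ => /(_ s); rewrite subKr.
have /choice[g gP] s := ultra_bounded_cvg FU (uM s).
have near_saddle k : 0 < k -> exists n, [/\ (z n).2 = (d, sigma), e n <= k &
    forall s, `|g s - u s n| <= k].
  move=> k0.
  have H1 : F [set n | e n <= k].
    apply: oF; have := near_infty_natSinv_lt (PosNum k0).
    by apply: filterS => n; exact: ltW.
  have H2 : F [set n | forall s, `|g s - u s n| <= k].
    by apply: filter_forall => s; move/cvgrPdist_le : (gP s); exact.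
  have H3 : F [set n | (z n).2 = (d, sigma)] by [].
  have FF : ProperFilter F by exact: ultra_proper.
  have /filter_ex[n [? []]] : F _ := @filterI _ _ FF _ _ H3 (@filterI _ _ FF _ _ H1 H2).
  by exists n.
(* Discounting is moved into the normalized value: [r + (1 - e) z = (r + z) - u] with [u = e z]. The
   undiscounted [z] will be the potential. *)
have split_l n b s a : lookahead Q r (1 - e n) (z n).1 b s a =
    \sum_s' Q b (s, a) s' * (r s a s' + (z n).1 s') - \sum_s' Q b (s, a) s' * u s' n.
  rewrite -sumrB; apply: eq_bigr => s' _; rewrite /u; ring.
have avg_r b s a (v : S -> R) : `|\sum_s' Q b (s, a) s' * (r s a s' + v s') -
    \sum_s' Q b (s, a) s' * v s'| <= M.
  rewrite averageD addrK ler_norml; apply/andP; split.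
    by apply: average_ge => // s'; have := rM s a s'; rewrite ler_norml => /andP[].
  by apply: average_le => // s'; have := rM s a s'; rewrite ler_norml => /andP[].
have avg_g b s a n k : (forall s, `|g s - u s n| <= k) ->
    `|\sum_s' Q b (s, a) s' * g s' - \sum_s' Q b (s, a) s' * u s' n| <= k.
  move=> gk; rewrite -sumrB; under eq_bigr do rewrite -mulrBr.
  rewrite ler_norml; apply/andP; split.
    by apply: average_ge => // s'; have := gk s'; rewrite ler_norml => /andP[].
  by apply: average_le => // s'; have := gk s'; rewrite ler_norml => /andP[].
have avg_u b s a n : \sum_s' Q b (s, a) s' * u s' n =
    e n * \sum_s' Q b (s, a) s' * (z n).1 s' by exact: averageZ.
have e1 n : e n <= 1 by rewrite invf_le1// ler1n.
have avg_M b s a n : `|\sum_s' Q b (s, a) s' * u s' n| <= M.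
  rewrite ler_norml; apply/andP; split.
    by apply: average_ge => // s'; have := uM s' n; rewrite ler_norml => /andP[].
  by apply: average_le => // s'; have := uM s' n; rewrite ler_norml => /andP[].
(* Multiplying the saddle inequality by [en] makes rewards negligible and turns [z] into [u], which
   is close to [g]. The errors are [2 q] from replacing [u] by [g] on both sides and at most
   [q * (1 + 2 * M)] from the rest. *)
have scalar x1 x2 x3 x4 zs gs en q : x4 - x3 <= zs + en -> 0 < en <= 1 ->
    en <= q -> x3 = en * x2 -> x3 <= M -> en * zs <= gs + q -> x1 - x3 <= q ->
    - M <= x4 - x2 -> x1 <= gs + q * (3 + 2 * M).
  move=> h1 /andP[en0 en1] enq x3E x3M ugq xq h2.
  have h3 : x2 - 2 * M <= zs + 1 by lra.
  have := ler_wpM2l (ltW en0) h3; rewrite mulrBr -x3E !mulrDr mulr1 => h4.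
  have : en * M <= q * M by rewrite ler_wpM2r.
  lra.
have scale k : 0 < k -> exists2 q, 0 < q & q * (3 + 2 * M) = k.
  move=> k0; have K0 : 0 < 3 + 2 * M by lra.
  by exists (k / (3 + 2 * M)); rewrite ?divr_gt0// divfK ?gt_eqF.
have g_super s a : \sum_s' Q (sigma (s, a)) (s, a) s' * g s' <= g s.
  apply/ler_addgt0Pr => k /scale[q q0 <-].
  have [n [zn en gn]] := near_saddle _ q0.
  have [_ + _] := zP n; rewrite zn/= => /(_ s a); rewrite split_l => h.
  apply: (scalar _ _ _ _ _ _ _ _ h _ en (avg_u _ _ _ _)).
  - by rewrite e0 e1.
  - exact: le_trans (ler_norm _) (avg_M _ _ _ _).
  - by have := gn s; rewrite ler_norml /u => /andP[]; lra.
  - exact: le_trans (ler_norm _) (avg_g _ _ _ _ _ gn).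
  - by have := avg_r (sigma (s, a)) s a (z n).1; rewrite ler_norml => /andP[].
have g_sub s b : g s <= \sum_s' Q b (s, d s) s' * g s'.
  rewrite -lerN2; apply/ler_addgt0Pr => k /scale[q q0 <-].
  have [n [zn en gn]] := near_saddle _ q0.
  have [_ _] := zP n; rewrite zn/= => /(_ s b); rewrite split_l => h.
  (* The lower inequality is [scalar] with all signs reversed. *)
  pose x i := - \sum_s' Q b (s, d s) s' * i s'.
  apply: (scalar (x g) (x (z n).1) (x (u^~ n))
    (x (fun s' => r s (d s) s' + (z n).1 s')) (- (z n).1 s) _ (e n)).
  - by rewrite /x; move: h; lra.
  - by rewrite e0 e1.
  - by [].
  - by rewrite /x avg_u mulrN.
  - by have := avg_M b s (d s) n; rewrite ler_norml /x => /andP[]; lra.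
  - by have := gn s; rewrite ler_norml /u => /andP[]; lra.
  - by have := avg_g b s (d s) n _ gn; rewrite ler_norml /x => /andP[]; lra.
  - by have := avg_r b s (d s) (z n).1; rewrite ler_norml /x => /andP[]; lra.
(* One half of [k] pays for the saddle error [e n], the other for replacing the average of [u] by
   that of [g]. *)
exists g, d, sigma; split=> // k k0; have k2 : 0 < k / 2 by rewrite divr_gt0.
have [n [zn en gn]] := near_saddle _ k2.
have [_ zn1 zn2] := zP n; rewrite zn/= in zn1 zn2; exists (z n).1; split => s.
  move=> a; have := zn1 s a; rewrite split_l.
  have := g_super s a; have := avg_g (sigma (s, a)) s a n _ gn.
  by rewrite ler_norml => /andP[]; lra.
move=> b; have := zn2 s b; rewrite split_l.
have := g_sub s b; have := avg_g b s (d s) n _ gn.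
by rewrite ler_norml => /andP[]; lra.
Qed.

End finite_game.

(** * Expectations of functions of finitely many coordinates *)

Section law_expectation.
Variables (R : realType) (S A : finPointedType).
Variables (p0 : S -> R) (pi : policy R S A) (P : transitions R S A).
Hypothesis p0_simplex : simplex R S p0.
Hypothesis pi_policy : history_policies R S A pi.
Hypothesis P_simplex : forall sa, simplex R S (P sa).

Let mu := law p0 pi P.
Let path (h : seq (S * A)) : nat -> S * A := nth point h.

Definition depends_on (T : Type) n (F : (nat -> S * A) -> T) :=
  forall w w', (forall t, (t < n)%N -> w t = w' t) -> F w = F w'.

Definition initial n (w : nat -> S * A) : n.-tuple (S * A) := [tuple w i | i < n].

Definition weight n (w : nat -> S * A) := \prod_(t < n) step_prob p0 pi P w t.

(** This is the expectation under [law] when [depends_on n F]; such an [F] does not see the default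
    [point] with which [path] continues a finite history. *)
Definition expect n (F : (nat -> S * A) -> R) :=
  \sum_(h : n.-tuple (S * A)) weight n (path h) * F (path h).

Lemma path_initial n w t : (t < n)%N -> path (initial n w) t = w t.
Proof. by move=> tn; rewrite /path -[t]/(nat_of_ord (Ordinal tn)) nth_mktuple. Qed.

Lemma depends_on_initial T n (F : (nat -> S * A) -> T) w :
  depends_on n F -> F (path (initial n w)) = F w.
Proof. by move=> dF; apply: dF => t tn; rewrite path_initial. Qed.

Lemma initial_pathP n (h : n.-tuple (S * A)) w :
  initial n w = h <-> (forall t, (t < n)%N -> w t = path h t).
Proof.
split=> [<- t tn|wh]; first by rewrite path_initial.
by apply: eq_from_tnth => i; rewrite tnth_mktuple wh// (tnth_nth point).
Qed.

Lemma measurable_initial n (h : n.-tuple (S * A)) :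
  measurable ([set w | initial n w = h] : set (trajectory S A)).
Proof.
have -> : [set w | initial n w = h] =
    \bigcap_t [set w | (t < n)%N -> w t = path h t].
  apply/seteqP; split=> w /=; first by move=> /initial_pathP wh t _; exact: wh.
  by move=> wh; apply/initial_pathP => t; exact: wh.
apply: bigcapT_measurable => t; apply: sub_sigma_algebra.
by exists t, [set x | (t < n)%N -> x = path h t].
Qed.

Lemma law_initial n (h : n.-tuple (S * A)) :
  mu [set w | initial n w = h] = (weight n (path h))%:E.
Proof.
rewrite -(lawP p0_simplex pi_policy P_simplex); congr (mu _).
by apply/seteqP; split=> w /initial_pathP.
Qed.

Lemma depends_on_indic n (F : (nat -> S * A) -> R) w : depends_on n F ->
  F w = \sum_(h : n.-tuple (S * A)) F (path h) * \1_[set w | initial n w = h] w.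
Proof.
move=> dF; rewrite (bigD1 (initial n w))//= big1 ?addr0 => [|h hw].
  by rewrite indicE mem_set// mulr1 depends_on_initial.
by rewrite indicE memNset ?mulr0// => /= /esym/eqP; exact/negP.
Qed.

Lemma integrable_depends_on n F : depends_on n F ->
  mu.-integrable setT (EFin \o F).
Proof.
move=> dF; rewrite (_ : _ \o _ = fun w => \sum_(h : n.-tuple (S * A))
    (F (path h))%:E * (\1_[set w | initial n w = h] w)%:E)%E; last first.
  by apply/funext => w /=; rewrite (depends_on_indic w dF) sumEFin.
apply: integrable_sum => //= h _; apply: integrableZl => //.
by apply: integrable_indic => //; exact: measurable_initial.
Qed.

Lemma integral_depends_on n F : depends_on n F ->
  (\int[mu]_w (F w)%:E = (expect n F)%:E)%E.
Proof.
move=> dF; transitivity (\int[mu]_w \sum_(h : n.-tuple (S * A))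
    (F (path h))%:E * (\1_[set w | initial n w = h] w)%:E)%E.
  by apply: eq_integral => w _; rewrite (depends_on_indic w dF) sumEFin.
have mi h := measurable_initial (n := n) h.
have ii h : mu.-integrable setT (fun w => (\1_[set w | initial n w = h] w)%:E).
  exact: integrable_indic.
rewrite integral_sum//; last by move=> h; apply: integrableZl.
rewrite /expect -sumEFin; apply: eq_bigr => h _.
rewrite integralZl// integral_indic// setIT.
by rewrite [X in (_ * X)%E](law_initial h) mulrC.
Qed.

Lemma expectD n F G : expect n (fun w => F w + G w) = expect n F + expect n G.
Proof. by rewrite -big_split; apply: eq_bigr => h _; rewrite mulrDr. Qed.

Lemma expectZ n c F : expect n (fun w => c * F w) = c * expect n F.
Proof. by rewrite mulr_sumr; apply: eq_bigr => h _; rewrite mulrCA. Qed.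

Lemma step_prob_ge0 w t : 0 <= step_prob p0 pi P w t.
Proof.
rewrite mulr_ge0//; last by case: (pi_policy (history w t) (w t).1).
by case: t => [|t]; [case: p0_simplex|case: (P_simplex (w t))].
Qed.

Lemma weight_ge0 n w : 0 <= weight n w.
Proof. by apply: prodr_ge0 => t _; exact: step_prob_ge0. Qed.

Lemma step_prob_depends n : depends_on n.+1 (fun w => step_prob p0 pi P w n).
Proof.
move=> w w' ww'; rewrite /step_prob ww'//; congr (_ * pi _ _ _).
  by case: n ww' => // n ww'; rewrite ww'.
apply: (@eq_from_nth _ point); rewrite !size_mkseq// => i ni.
by rewrite !nth_mkseq// ww'// ltnW.
Qed.

Lemma weight_depends n : depends_on n (weight n).
Proof.
move=> w w' ww'; apply: eq_bigr => t _; apply: step_prob_depends => i it.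
by apply: ww'; exact: leq_trans it _.
Qed.

Lemma path_rcons n (h : n.-tuple (S * A)) x t : (t < n)%N ->
  path (rcons h x) t = path h t.
Proof. by move=> tn; rewrite /path nth_rcons size_tuple tn. Qed.

Lemma expect_rcons n F : expect n.+1 F = \sum_(h : n.-tuple (S * A))
  weight n (path h) *
  \sum_x step_prob p0 pi P (path (rcons h x)) n * F (path (rcons h x)).
Proof.
pose f (hx : n.-tuple (S * A) * (S * A)) := [tuple of rcons hx.1 hx.2].
pose g (h : n.+1.-tuple (S * A)) := (initial n (path h), path h n).
have fK : cancel f g.
  move=> [h x]; rewrite /g /f /=; congr pair.
    by apply/initial_pathP => t tn; rewrite path_rcons.
  by rewrite /path nth_rcons size_tuple ltnn eqxx.
have gK : cancel g f.
  move=> h; apply: eq_from_tnth => i; rewrite !(tnth_nth point).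
  rewrite -[LHS]/(path (rcons (initial n (path h)) (path h n)) i).
  case: (ltnP i n) => [ni|ni]; first by rewrite path_rcons// path_initial.
  have -> : i = n :> nat by apply/eqP; rewrite eqn_leq ni -ltnS ltn_ord.
  by rewrite {1}/path nth_rcons size_tuple ltnn eqxx.
rewrite /expect (reindex f); last by exists g => ? _.
rewrite -(pair_bigA _
  (fun h x => weight n.+1 (path (f (h, x))) * F (path (f (h, x)))))/=.
apply: eq_bigr => h _; rewrite mulr_sumr; apply: eq_bigr => x _.
rewrite mulrA {1}/weight big_ord_recr/=; congr (_ * _ * _).
by apply: weight_depends => t; exact: path_rcons.
Qed.

Lemma expect_init F : expect 1 (fun w => F (w 0).1) = \sum_s p0 s * F s.
Proof.
rewrite expect_rcons (big_pred1 [tuple]) => [|h]; last first.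
  by rewrite [h]tuple0; exact/esym/eqP.
rewrite /weight big_ord0 mul1r.
rewrite -(pair_bigA _ (fun s a => p0 s * pi [::] s a * F s))/=.
apply: eq_bigr => s _; rewrite -mulr_suml -mulr_sumr.
by case: (pi_policy [::] s) => _ ->; rewrite mulr1.
Qed.

(** Condition on the first [n.+1] pairs: the next state has law [P (w n)] and the next action sums
    out. Asking for the inequality only at actions of nonzero probability lets it be used when it is
    known only for the actions of a deterministic policy. *)
Lemma expect_step n (K : (nat -> S * A) -> S -> R) (G : (nat -> S * A) -> R) :
  (forall s, depends_on n.+1 (K^~ s)) ->
  (forall w, pi (history w n) (w n).1 (w n).2 != 0 ->
     \sum_s P (w n) s * K w s <= G w) ->
  expect n.+2 (fun w => K w (w n.+1).1) <= expect n.+1 G.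
Proof.
move=> dK KG; rewrite expect_rcons; apply: ler_sum => h _.
(* A history of nonzero weight ends with an action of nonzero probability, so the hypothesis applies
   to it. *)
have [->|w0] := eqVneq (weight n.+1 (path h)) 0; first by rewrite !mul0r.
rewrite ler_wpM2l ?weight_ge0//; apply: le_trans (KG _ _); last first.
  apply: contra_neq w0 => pi0.
  by rewrite /weight big_ord_recr/= {2}/step_prob pi0 !mulr0.
rewrite le_eqVlt; apply/orP; left; apply/eqP.
transitivity (\sum_s \sum_a
    P (path h n) s * pi (history (path h) n.+1) s a * K (path h) s).
  rewrite pair_bigA; apply: eq_bigr => -[s a] _.
  have nx : path (rcons h (s, a)) n.+1 = (s, a).
    by rewrite /path nth_rcons size_tuple ltnn eqxx.
  rewrite /step_prob nx path_rcons//; congr (_ * pi _ _ _ * _); last first.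
    by apply: (dK s) => t; exact: path_rcons.
  apply: (@eq_from_nth _ point); rewrite !size_mkseq// => i ni.
  by rewrite !nth_mkseq// path_rcons.
apply: eq_bigr => s _; rewrite -mulr_suml -mulr_sumr.
by case: (pi_policy (history (path h) n.+1) s) => _ ->; rewrite mulr1.
Qed.

End law_expectation.

(** * Bounds on the limsup average *)

(** Since [1 - x <= expR (- x)], the claim reduces to [1 <= (1 - x) (1 + x + 2 x^2)], whose two
    sides differ by [x^2 (1 - 2 x)]. *)
Lemma expR_le_quadratic (R : realType) (x : R) :
  `|x| <= 2^-1 -> expR x <= 1 + x + 2 * x ^+ 2.
Proof.
rewrite ler_norml => /andP[xl xr]; have x1 : 0 < 1 - x by lra.
have h : expR x <= (1 - x)^-1.
  rewrite -[expR x]invrK lef_pV2 ?posrE ?invr_gt0 ?expR_gt0// -expRN.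
  exact: expR_ge1Dx.
apply: le_trans h _; rewrite -[leLHS]div1r ler_pdivrMr//.
have : 0 <= x ^+ 2 * (1 - 2 * x) by rewrite mulr_ge0 ?sqr_ge0//; lra.
rewrite -subr_ge0 => h'; rewrite -subr_ge0; move: h'; congr (0 <= _).
by rewrite !(exprS, expr0); ring.
Qed.

Lemma telescope_le (R : realType) (a b : nat -> R) c m n : (m <= n)%N ->
  (forall t, c * a t <= b t - b t.+1) -> c * \sum_(m <= t < n) a t <= b m - b n.
Proof.
move=> mn ab; rewrite mulr_sumr -[leRHS]opprB -(telescope_sumr b mn) -sumrN.
by apply: ler_sum => t _; rewrite opprB.
Qed.

(** [gap] is the least distance between distinct values of [g], capped at 1; square-summable
    increments thereby become absolutely summable. *)
Lemma fin_gap (R : realType) (T : finType) (g : T -> R) :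
  exists2 gap, 0 < gap & forall x y, gap * `|g x - g y| <= (g x - g y) ^+ 2.
Proof.
exists (\big[Num.min/1]_(z : T * T | g z.1 != g z.2) `|g z.1 - g z.2|).
  by apply: lt_bigmin => [|z gz]; [exact: ltr01|rewrite normr_gt0 subr_eq0].
move=> x y; have [->|gxy] := eqVneq (g x) (g y).
  by rewrite subrr normr0 mulr0 expr0n.
rewrite -real_normK ?num_real// expr2 ler_wpM2r//.
exact: (@bigmin_le_cond _ _ _ _ (x, y)).
Qed.

Section average_reward_bound.
Variables (R : realType) (S A : finPointedType).
Variables (p0 : S -> R) (pi : policy R S A) (P : transitions R S A).
Hypothesis p0_simplex : simplex R S p0.
Hypothesis pi_policy : history_policies R S A pi.
Hypothesis P_simplex : forall sa, simplex R S (P sa).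

Let mu := law p0 pi P.
Let expect := expect p0 pi P.

Lemma expect_cst n c : expect n (fun=> c) = c.
Proof.
apply: EFin_inj; rewrite -(integral_depends_on p0_simplex pi_policy P_simplex)//.
transitivity (c%:E * mu setT)%E; first exact: (integral_cst mu measurableT).
by rewrite /mu probability_setT mule1.
Qed.

Lemma ler_expect n F G : (forall w, F w <= G w) -> expect n F <= expect n G.
Proof.
by move=> FG; apply: ler_sum => h _; rewrite ler_wpM2l// (weight_ge0 p0_simplex).
Qed.

(** Sum and integral commute by nonnegativity. The full series will serve as one integrable majorant
    of error terms that vary with the horizon. *)
Lemma integral_series (u : nat -> (nat -> S * A) -> R) (m : nat -> nat) c :
  (forall t, depends_on (m t) (u t)) -> (forall t w, 0 <= u t w) ->
  (forall n, \sum_(0 <= t < n) expect (m t) (u t) <= c) ->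
  [/\ mu.-integrable setT (fun w => \sum_(0 <= t <oo) (u t w)%:E)%E,
      (\int[mu]_w (\sum_(0 <= t <oo) (u t w)%:E) <= c%:E)%E &
      forall n w, ((\sum_(0 <= t < n) u t w)%:E <= \sum_(0 <= t <oo) (u t w)%:E)%E].
Proof.
move=> du u0 uc.
have mu_ t : measurable_fun setT (fun w : trajectory S A => (u t w)%:E).
  exact: (measurable_int mu (integrable_depends_on p0 pi P (du t))).
have uc' : (\int[mu]_w (\sum_(0 <= t <oo) (u t w)%:E) <= c%:E)%E.
  rewrite integral_nneseries//; last by move=> t w _; rewrite lee_fin.
  apply: lime_le.
    by apply: is_cvg_nneseries => t _ _; apply: integral_ge0 => w _; rewrite lee_fin.
  apply: nearW => n /=; under eq_bigr do
    rewrite (integral_depends_on p0_simplex pi_policy P_simplex (du _)).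
  by rewrite sumEFin lee_fin.
split=> // [|n w]; last first.
  rewrite -sumEFin; apply: nneseries_lim_ge => t _ _; exact: u0.
apply/integrableP; split.
  by apply: ge0_emeasurable_sum => // t w _ _; rewrite lee_fin.
apply: le_lt_trans (ltry c); apply: le_trans uc'; rewrite le_eqVlt; apply/orP; left.
apply/eqP; apply: eq_integral => w _; rewrite gee0_abs//.
by apply: nneseries_ge0 => t _ _; rewrite lee_fin.
Qed.

Variables (r : S -> A -> S -> R) (g : S -> R).
Hypothesis g_super : forall h s a, pi h s a != 0 -> \sum_s' P (s, a) s' * g s' <= g s.

Lemma expect_supermartingale n : expect n.+1 (fun w => g (w n).1) <= \sum_s p0 s * g s.
Proof.
elim: n => [|n ih].
  by rewrite /expect (expect_init p0 P pi_policy).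
apply: le_trans ih.
apply: (expect_step p0_simplex pi_policy P_simplex (K := fun _ s => g s)) => // w.
by case: (w n) => s a; exact: g_super.
Qed.

(* The increments of [C - g], a bounded nonnegative submartingale, are
   square-summable, and the finitely many values of [g] are separated. *)
Lemma variation_summable e : 0 < e -> exists N, forall n,
  \sum_(0 <= t < n) expect (N + t).+2
     (fun w => `|g (w (N + t)%N.+1).1 - g (w (N + t)%N).1|) <= e.
Proof.
move=> e0; have [C C1 gC] := fin_bounded g; have [gap gap0 gapP] := fin_gap g.
pose Y s := C - g s.
have Y0 s : 0 <= Y s by have := gC s; rewrite ler_norml subr_ge0 => /andP[].
have YC s : Y s <= 2 * C by have := gC s; rewrite ler_norml /Y => /andP[]; lra.
pose y n := expect n.+1 (fun w => Y (w n).1 ^+ 2).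
pose a n := expect n.+2 (fun w => `|g (w n.+1).1 - g (w n).1|).
have ya n : gap * a n <= y n.+1 - y n.
  (* [K] plus the square of the next [Y] is the squared increment, and the conditional mean of [K]
     is at most minus the square of the current [Y], because [Y] is a nonnegative submartingale. *)
  pose K (w : nat -> S * A) s := Y (w n).1 ^+ 2 - 2 * Y (w n).1 * Y s.
  have h1 : expect n.+2 (fun w => K w (w n.+1).1) <= - y n.
    rewrite /y -mulN1r -[X in _ <= X](expectZ p0 pi P).
    apply: (expect_step p0_simplex pi_policy P_simplex) => [s w w' ww'|w].
      by rewrite /K ww'.
    rewrite mulN1r /K; case: (w n) => s b /g_super gs /=.
    rewrite [leLHS](_ : _ = Y s ^+ 2 - 2 * Y s * (C - \sum_s' P (s, b) s' * g s')).
      have := ler_wpM2l (Y0 s) gs; rewrite /Y; nra.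
      rewrite -[X in _ = X - _](average_cst (P_simplex (s, b)) (Y s ^+ 2)).
      rewrite -[X in _ - _ * (X - _)](average_cst (P_simplex (s, b)) C).
      rewrite -!sumrB mulr_sumr -sumrB.
      by apply: eq_bigr => s' _; rewrite /Y; ring.
  have h2 : gap * a n <= expect n.+2 (fun w => K w (w n.+1).1 + Y (w n.+1).1 ^+ 2).
    rewrite -[leLHS](expectZ p0 pi P); apply: ler_expect => w.
    apply: le_trans (gapP _ _) _; rewrite /K /Y le_eqVlt; apply/orP; left.
    by apply/eqP; ring.
  apply: le_trans h2 _; rewrite [leLHS](expectD p0 pi P) addrC lerD2l.
  exact: h1.
have y0 n : 0 <= y n.
  by rewrite -(expect_cst n.+1 0); apply: ler_expect => w; exact: sqr_ge0.
have yC n : y n <= (2 * C) ^+ 2.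
  rewrite -(expect_cst n.+1 ((2 * C) ^+ 2)); apply: ler_expect => w.
  by rewrite ler_pXn2r// ?nnegrE//; lra.
(* Once [y N] is within [gap * e] of the supremum of [y], the telescoped variation after [N] is at
   most [e]. *)
have [_ [N _ <-] hN] : exists2 z, range y z & sup (range y) - gap * e < z.
  apply: sup_adherent; first by rewrite mulr_gt0.
  by split; [exists (y 0%N), 0%N|exists ((2 * C) ^+ 2) => _ [n _ <-]].
exists N => n; rewrite -(ler_pM2l gap0).
rewrite (eq_bigr (fun t => a (N + t)%N))//.
have ya' t : gap * a (N + t)%N <= - y (N + t)%N - - y (N + t.+1)%N.
  by rewrite opprK addrC addnS.
apply: le_trans (telescope_le (leq0n n) ya') _; rewrite opprK addrC addn0.
rewrite lerBlDl -lerBlDr; apply: le_trans (ltW hN); rewrite lerD2r.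
apply: ub_le_sup; last by exists (N + n)%N.
by exists ((2 * C) ^+ 2) => _ [k _ <-].
Qed.

(* [Z] is, up to scaling, the exponential of a small multiple of the sum of
   [r - g - 2 e] plus the increments of the potential [f]: its expectation
   decreases geometrically. *)
Lemma exponential_bound e f : 0 < e ->
  (forall h s a, pi h s a != 0 ->
    \sum_s' P (s, a) s' * (r s a s' + f s') <= f s + g s + e) ->
  exists (Z : nat -> (nat -> S * A) -> R) c,
  [/\ forall n, depends_on n.+1 (Z n), forall n w, 0 <= Z n w,
      forall n w, \sum_(0 <= t < n) r (w t).1 (w t).2 (w t.+1).1 <=
        \sum_(0 <= t < n) g (w t).1 + n%:R * (2 * e) + Z n w + c &
      forall n, \sum_(0 <= t < n) expect t.+1 (Z t) <= c].
Proof.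
move=> e0 fe; have [F F1 fF] := fin_bounded f.
(* The potential inequality has slack [e], so subtracting [2 * e] leaves a conditional drift of at
   most [- e]. *)
pose u (x : S * A) s' := r x.1 x.2 s' - g x.1 - 2 * e + f s' - f x.1.
have [M0 M01 uM0] := fin_bounded (fun z : S * A * S => u z.1 z.2).
pose M := M0 + e; have M_gt0 : 0 < M by rewrite /M; lra.
have uM x s' : `|u x s'| <= M.
  by apply: le_trans (uM0 (x, s')) _; rewrite lerDl ltW.
(* The quadratic term [2 (theta M)^2] is then [theta * e / 2], half of the gain [theta * e] from the
   drift. Adding [e] to [M0] keeps [theta * M] below one half. *)
pose theta := e / (4 * M ^+ 2).
have theta0 : 0 < theta by rewrite divr_gt0// mulr_gt0// exprn_gt0.
have thetaM : theta * M ^+ 2 = e / 4.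
  by rewrite /theta; field; rewrite gt_eqF.
have thetaM2 : theta * M <= 2^-1.
  rewrite -(ler_pM2r M_gt0) -mulrA -expr2 thetaM /M; lra.
pose X n (w : nat -> S * A) := \sum_(0 <= t < n) u (w t) (w t.+1).1.
pose E n w := expR (theta * X n w).
have dX n : depends_on n.+1 (X n).
  move=> w w' ww'; apply: eq_big_nat => t /andP[_ tn].
  by rewrite !ww'// ltnW.
have step_u h s a : pi h s a != 0 ->
    \sum_s' P (s, a) s' * expR (theta * u (s, a) s') <= 1 - theta * e / 2.
  move=> hsa; have Pu : \sum_s' P (s, a) s' * u (s, a) s' <= - e.
    have -> : \sum_s' P (s, a) s' * u (s, a) s' =
        \sum_s' P (s, a) s' * (r s a s' + f s') - (g s + 2 * e + f s).
      rewrite -[X in _ - X](average_cst (P_simplex (s, a))) -sumrB.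
      by apply: eq_bigr => s' _; rewrite /u/=; ring.
    by have := fe _ _ _ hsa; lra.
  have h1 s' : expR (theta * u (s, a) s') <= 1 + theta * e / 2 + theta * u (s, a) s'.
    have h2 : `|theta * u (s, a) s'| <= theta * M.
      by rewrite normrM gtr0_norm// ler_pM2l.
    apply: le_trans (expR_le_quadratic (le_trans h2 thetaM2)) _.
    rewrite addrAC lerD2r lerD2l.
    have h3 : (theta * u (s, a) s') ^+ 2 <= (theta * M) ^+ 2.
      by rewrite -[leLHS]real_normK ?num_real// ler_pXn2r// nnegrE ltW// mulr_gt0.
    have h4 : (theta * M) ^+ 2 = theta * (e / 4).
      by rewrite -thetaM; ring.
    by rewrite h4 in h3; lra.
  apply: le_trans (ler_average (P_simplex (s, a)) h1) _.
  rewrite averageD average_cst// averageZ.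
  have := ler_wpM2l (ltW theta0) Pu; lra.
have stepE n : expect n.+2 (E n.+1) <= (1 - theta * e / 2) * expect n.+1 (E n).
  rewrite -[leRHS](expectZ p0 pi P).
  have -> : expect n.+2 (E n.+1) =
      expect n.+2 (fun w => E n w * expR (theta * u (w n) (w n.+1).1)).
    apply: eq_bigr => h _; congr (_ * _).
    by rewrite /E /X big_nat_recr//= mulrDr expRD.
  apply: (expect_step p0_simplex pi_policy P_simplex
    (K := fun w s => E n w * expR (theta * u (w n) s))) => [s w w' ww'|w pi0].
    by rewrite /E (dX _ _ _ ww') ww'.
  rewrite averageZ mulrC ler_wpM2r ?expR_ge0//.
  by move: pi0; case: (w n) => s a; exact: step_u.
have E0 : expect 1 (E 0%N) = 1.
  rewrite -(expect_cst 1 1); apply: eq_bigr => h _.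
  by rewrite /E /X big_geq// mulr0 expR0.
have te0 : 0 < theta * e / 2 by rewrite divr_gt0// mulr_gt0.
(* Geometric decay bounds each term by a decrement of the expectation of [E], which starts at 1. *)
have sumE n : theta * e / 2 * (\sum_(0 <= t < n) expect t.+1 (E t)) <= 1.
  have h t : theta * e / 2 * expect t.+1 (E t) <=
      expect t.+1 (E t) - expect t.+2 (E t.+1) by have := stepE t; lra.
  apply: le_trans (telescope_le (b := fun t => expect t.+1 (E t)) (leq0n n) h) _.
  rewrite E0 gerBl -(expect_cst n.+1 0); apply: ler_expect => w; exact: expR_ge0.
pose c := theta^-1 * (theta * e / 2)^-1.
have c0 : 0 < c by rewrite mulr_gt0 ?invr_gt0.
(* [Z] dominates [X] since [x <= expR x]; [2 * F] absorbs the boundary terms of the potential. *)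
exists (fun n w => theta^-1 * E n w), (c + 2 * F); split.
- by move=> n w w' ww'; rewrite /E (dX _ _ _ ww').
- by move=> n w; rewrite mulr_ge0 ?invr_ge0 ?expR_ge0// ltW.
- move=> n w.
  have h1 : X n w <= theta^-1 * E n w.
    rewrite ler_pdivlMl//; apply: le_trans (expR_ge1Dx _); rewrite lerDr//.
  have h2 : X n w = \sum_(0 <= t < n) r (w t).1 (w t).2 (w t.+1).1 -
      \sum_(0 <= t < n) g (w t).1 - n%:R * (2 * e) + (f (w n).1 - f (w 0%N).1).
    rewrite -(telescope_sumr (fun t => f (w t).1) (leq0n n)).
    rewrite -[n in n%:R]subn0 mulr_natl -sumr_const_nat -!sumrB -big_split/=.
    by apply: eq_bigr => t _; rewrite /u; ring.
  have := fF (w n).1; have := fF (w 0%N).1; rewrite !ler_norml.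
  move: h1; rewrite h2; lra.
- move=> n; rewrite (eq_bigr (fun t => theta^-1 * expect t.+1 (E t))); last first.
    by move=> t _; exact: expectZ.
  rewrite -mulr_sumr; apply: (@le_trans _ _ c); last by lra.
  by rewrite ler_pM2l ?invr_gt0// -[leRHS]mul1r ler_pdivlMr// mulrC.
Qed.

Definition average_reward (rew : S -> A -> S -> R) (w : nat -> S * A) T :=
  T.+1%:R^-1 * \sum_(t < T.+1) rew (w t).1 (w t).2 (w t.+1).1.

Lemma average_reward_depends rew T :
  depends_on T.+2 (fun w => average_reward rew w T).
Proof.
move=> w w' ww'; congr (_ * _); apply: eq_bigr => t _.
by rewrite !ww'// ltnS// ltnW.
Qed.

Lemma limn_esup_le (u : nat -> \bar R) l m :
  (forall n, (m <= n)%N -> (u n <= l)%E) -> (limn_esup u <= l)%E.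
Proof.
move=> ul; rewrite /limn_esup limf_esupE; apply: ge_ereal_inf.
exists (ereal_sup [set u x | x in [set n | (m <= n)%N]]).
  by exists [set n | (m <= n)%N] => //; exact: nbhs_infty_ge.
by apply: ge_ereal_sup => _ [n mn <-]; exact: ul.
Qed.

Lemma limn_esup_ge (u : nat -> \bar R) l :
  (forall n, (l <= u n)%E) -> (l <= limn_esup u)%E.
Proof.
move=> ul; rewrite /limn_esup limf_esupE; apply: le_ereal_inf_tmp => _ [V Voo <-].
have [n Vn] := filter_ex Voo.
by apply: le_trans (ul n) _; apply: ereal_sup_ubound; exists n.
Qed.

Lemma limn_esup_integrable rew :
  mu.-integrable setT (fun w => limn_esup (fun T => (average_reward rew w T)%:E)).
Proof.
have [M M1 rM] := fin_bounded (fun z : S * A * S => rew z.1.1 z.1.2 z.2).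
have avgM w T : `|average_reward rew w T| <= M.
  rewrite /average_reward normrM gtr0_norm ?invr_gt0// ler_pdivrMl//.
  apply: le_trans (ler_norm_sum _ _ _) _.
  rewrite mulr_natl -[X in M *+ X]card_ord -sumr_const; apply: ler_sum => t _.
  exact: (rM (w t, (w t.+1).1)).
have mavg T : measurable_fun setT
    (fun w : trajectory S A => (average_reward rew w T)%:E).
  exact: (measurable_int mu
    (integrable_depends_on p0 pi P (@average_reward_depends rew T))).
apply: (le_integrable measurableT _ _ (finite_measure_integrable_cst mu M measurableT)).
  exact: measurable_fun_limn_esup.
move=> w _ /=; rewrite (ger0_norm (le_trans ler01 M1)).
have : (limn_esup (fun T => (average_reward rew w T)%:E) <= M%:E)%E.
  by apply: (@limn_esup_le _ _ 0) => T _; rewrite lee_fin (le_trans (ler_norm _)).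
have : ((- M)%:E <= limn_esup (fun T => (average_reward rew w T)%:E))%E.
  by apply: limn_esup_ge => T; rewrite lee_fin lerNl (le_trans (ler_norm _))// normrN.
by case: limn_esup => [x| |]//=; rewrite !lee_fin ler_norml => -> ->.
Qed.

(** Along each trajectory the limsup is at most [g] at time [N], plus the variation of [g] after
    [N], plus a small multiple of the series of [Z], plus [3 * e]. Integrating, the supermartingale
    property handles the first term. *)
Lemma Ravg_le :
  (forall e, 0 < e -> exists f : S -> R, forall h s a, pi h s a != 0 ->
    \sum_s' P (s, a) s' * (r s a s' + f s') <= f s + g s + e) ->
  (Ravg p0 pi P r <= (\sum_s p0 s * g s)%:E)%E.
Proof.
move=> pot; apply/lee_addgt0Pr => k k0.
(* The errors add up to [5 * e]: [3 * e] pointwise and [e] for each of the two series. *)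
pose e := k / 6; have e0 : 0 < e by rewrite divr_gt0.
have [f fe] := pot _ e0.
have [Z [c [dZ Z0 Zr Zc]]] := exponential_bound e0 fe.
have [N DN] := variation_summable e0.
have [C C1 gC] := fin_bounded g.
pose D t (w : nat -> S * A) := `|g (w (N + t)%N.+1).1 - g (w (N + t)%N).1|.
have dD t : depends_on (N + t).+2 (D t) by move=> w w' ww'; rewrite /D !ww'.
have c0 : 0 <= c by have := Zc 0%N; rewrite big_geq.
(* Scaled by [delta], the series of [Z] has expectation at most [e]; as soon as [T.+1%:R * delta]
   exceeds 1, [delta * Z] dominates [Z] divided by the horizon. *)
pose delta := e / (c + 1); have c1 : 0 < c + 1 by lra.
have delta0 : 0 < delta by rewrite divr_gt0.
have [m Nm mP] : exists2 m, (N <= m)%N & forall T, (m <= T)%N ->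
    1 <= T.+1%:R * delta /\ c + 2 * C * N%:R <= T.+1%:R * e.
  pose x := delta^-1 + (c + 2 * C * N%:R) / e.
  have y0 : 0 <= (c + 2 * C * N%:R) / e.
    by rewrite divr_ge0 ?(ltW e0)// addr_ge0// !mulr_ge0//; lra.
  have x0 : 0 <= x by rewrite addr_ge0// invr_ge0 ltW.
  exists (N + Num.bound x)%N => [|T mT]; first exact: leq_addr.
  have xT : x <= T.+1%:R.
    apply: le_trans (ltW (archi_boundP x0)) _.
    by rewrite ler_nat (leq_trans (leq_addl N _))// (leq_trans mT).
  rewrite -ler_pdivrMr// div1r -ler_pdivrMr//.
  by split; apply: le_trans xT; rewrite /x ?lerDl ?lerDr ?invr_ge0// ltW.
pose Zd t w := delta * Z t w.
have dZd t : depends_on t.+1 (Zd t) by move=> w w' ww'; rewrite /Zd (dZ _ _ _ ww').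
have Zd0 t w : 0 <= Zd t w by rewrite mulr_ge0// ltW.
have Zdc n : \sum_(0 <= t < n) expect t.+1 (Zd t) <= e.
  rewrite (eq_bigr (fun t => delta * expect t.+1 (Z t))); last first.
    by move=> t _; exact: expectZ.
  rewrite -mulr_sumr; apply: le_trans (ler_wpM2l (ltW delta0) (Zc n)) _.
  by rewrite /delta mulrAC ler_pdivrMr// ler_pM2l//; lra.
have [iZ ieZ leZ] := integral_series dZd Zd0 Zdc.
have [iD ieD leD] := integral_series dD (fun t w => normr_ge0 _) DN.
have dg : depends_on N.+1 (fun w : nat -> S * A => g (w N).1 + 3 * e).
  by move=> w w' ww'; rewrite ww'.
have ig := integrable_depends_on p0 pi P dg.
have bound w T : (m <= T)%N -> average_reward r w T <=
    g (w N).1 + 3 * e + \sum_(0 <= t < T.+1 - N) D t w + Zd T.+1 w.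
  move=> mT; have [m1 m2] := mP T mT.
  rewrite /average_reward ler_pdivrMl//.
  rewrite -(big_mkord xpredT (fun t => r (w t).1 (w t).2 (w t.+1).1)).
  apply: le_trans (Zr T.+1 w) _; rewrite /Zd.
  set V := \sum_(0 <= t < _) D t w.
  have NT : (N <= T.+1)%N by rewrite (leq_trans Nm)// (leq_trans mT).
  have gV t : (t <= T.+1 - N)%N -> g (w (N + t)%N).1 <= g (w N).1 + V.
    move=> tT; rewrite -lerBlDl.
    have := telescope_sumr (fun i => g (w (N + i)%N).1) (leq0n t).
    rewrite addn0 => <-; rewrite /V (big_cat_nat (leq0n t) tT)//= -[leLHS]addr0.
    apply: lerD; last by apply: sumr_ge0 => i _; exact: normr_ge0.
    by apply: ler_sum => i _; rewrite /D addnS ler_norm.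
  (* Each of the first [N] terms costs at most [2 * C] more than the common bound [g (w N).1 + V],
     which is at least [- C]. *)
  have sum_g : \sum_(0 <= t < T.+1) g (w t).1 <=
      T.+1%:R * (g (w N).1 + V) + 2 * C * N%:R.
    rewrite (big_cat_nat (leq0n N) NT)//=.
    rewrite [X in _ + X <= _]
      (_ : _ = \sum_(0 <= t < T.+1 - N) g (w (t + N)%N).1); last first.
      by rewrite -{1}[N]add0n big_addn.
    have h1 : \sum_(0 <= t < N) g (w t).1 <= N%:R * C.
      rewrite mulr_natl -{2}[N]subn0 -sumr_const_nat; apply: ler_sum => t _.
      exact: le_trans (ler_norm _) (gC _).
    have h2 : \sum_(0 <= t < T.+1 - N) g (w (t + N)%N).1 <=
        (T.+1 - N)%:R * (g (w N).1 + V).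
      rewrite mulr_natl -{2}[(T.+1 - N)%N]subn0 -sumr_const_nat.
      apply: ler_sum_nat => t /andP[_ tT].
      by rewrite addnC gV// ltnW.
    have h3 : 0 <= N%:R * (g (w N).1 + V + C).
      rewrite mulr_ge0//; have := gC (w N).1; rewrite ler_norml => /andP[gN _].
      have : 0 <= V by apply: sumr_ge0 => i _; exact: normr_ge0.
      by lra.
    move: h2; rewrite natrB//; lra.
  have hZ := ler_wpM2r (Z0 T.+1 w) m1.
  by move: sum_g; rewrite mul1r in hZ; lra.
have bound' w : (limn_esup (fun T => (average_reward r w T)%:E) <=
    (g (w N).1 + 3 * e)%:E + (\sum_(0 <= t <oo) (D t w)%:E) +
    (\sum_(0 <= t <oo) (Zd t w)%:E))%E.
  apply: (@limn_esup_le _ _ m) => T mT.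
  apply: (@le_trans _ _
    ((g (w N).1 + 3 * e + \sum_(0 <= t < T.+1 - N) D t w + Zd T.+1 w)%:E)).
    by rewrite lee_fin; exact: bound.
  rewrite !EFinD; apply: leeD; first by apply: leeD => //; exact: leD.
  (* The partial sum must run to [T.+2] to contain the term of index [T.+1]. *)
  apply: le_trans (leZ T.+2 w); rewrite lee_fin big_nat_recr//= lerDr.
  by apply: sumr_ge0.
apply: le_trans
  (le_integral measurableT (limn_esup_integrable r) _ (fun w _ => bound' w)) _.
  by apply: integrableD => //; exact: integrableD.
rewrite integralD//; last exact: integrableD.
rewrite integralD// (integral_depends_on p0_simplex pi_policy P_simplex dg).
apply: (@le_trans _ _ ((\sum_s p0 s * g s + 3 * e)%:E + e%:E + e%:E)%E); last first.
  by rewrite -!EFinD lee_fin /e; lra.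
apply: leeD => //; apply: leeD => //; rewrite lee_fin [leLHS](expectD p0 pi P).
by rewrite -/expect expect_cst lerD2r; exact: expect_supermartingale.
Qed.

End average_reward_bound.

(** * Strong duality *)

(** Negate [r], [g] and [f] in [Ravg_le]; minus the limsup of the negated averages is their liminf,
    which is below the limsup. *)
Lemma Ravg_ge (R : realType) (S A : finPointedType) (p0 : S -> R)
    (pi : policy R S A) (P : transitions R S A) (r : S -> A -> S -> R) (g : S -> R) :
  simplex R S p0 -> history_policies R S A pi -> (forall sa, simplex R S (P sa)) ->
  (forall h s a, pi h s a != 0 -> g s <= \sum_s' P (s, a) s' * g s') ->
  (forall e, 0 < e -> exists f : S -> R, forall h s a, pi h s a != 0 ->
    f s + g s - e <= \sum_s' P (s, a) s' * (r s a s' + f s')) ->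
  ((\sum_s p0 s * g s)%:E <= Ravg p0 pi P r)%E.
Proof.
move=> p0_simplex pi_policy P_simplex g_sub pot.
pose r' s a s' := - r s a s'.
have int_r := limn_esup_integrable p0 pi P r.
have int_r' := limn_esup_integrable p0 pi P r'.
have Ravg'_le : (Ravg p0 pi P r' <= (\sum_s p0 s * - g s)%:E)%E.
  apply: Ravg_le => // [h s a /g_sub|e /pot[f fP]].
    by under [in X in _ -> X]eq_bigr do rewrite mulrN; rewrite sumrN lerN2.
  exists (fun s => - f s) => h s a /fP; rewrite -lerN2 -sumrN => fs.
  rewrite (eq_bigr (fun s' => - (P (s, a) s' * (r s a s' + f s')))); last first.
    by move=> s' _; rewrite /r'; ring.
  by apply: le_trans fs _; rewrite le_eqVlt; apply/orP; left; apply/eqP; ring.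
have le_limn w : (-1%:E * limn_esup (fun T => (average_reward r' w T)%:E) <=
    limn_esup (fun T => (average_reward r w T)%:E))%E.
  rewrite mulN1e.
  rewrite (_ : (fun T => _) = -%E \o (fun T => (average_reward r w T)%:E)); last first.
    by apply/funext => T /=; rewrite /average_reward sumrN mulrN.
  by rewrite limn_esupN oppeK; exact: limn_einf_sup.
apply: (@le_trans _ _ (-1%:E * Ravg p0 pi P r')%E).
  rewrite mulN1e leeNr -EFinN -sumrN.
  by under eq_bigr do rewrite -mulrN.
rewrite [X in (-1%:E * X)%E](_ : _ = \int[law p0 pi P]_w
  limn_esup (fun T => (average_reward r' w T)%:E))%E//.
rewrite -integralZl//; apply: le_integral => //; exact: integrableZl.
Qed.

Theorem theorem3p5 (R : realType) (S A : finPointedType)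
  (r : S -> A -> S -> R) (p0 : S -> R) (U : set (transitions R S A))
  (p0_simplex : simplex R S p0)
  (U_nonempty : U !=set0)
  (U_compact : compact U)
  (U_rect : sa_rectangular U) :
  ereal_sup [set ereal_inf [set Ravg p0 pi P r | P in U]
            | pi in history_policies R S A]
  = ereal_inf [set ereal_sup [set Ravg p0 pi P r
                             | pi in history_policies R S A]
              | P in U]
  /\
  \big[maxe/-oo%E]_(d : {ffun S -> A})
     ereal_inf [set Ravg p0 (sd_policy R d) P r | P in U]
  = ereal_inf [set \big[maxe/-oo%E]_(d : {ffun S -> A})
                     Ravg p0 (sd_policy R d) P r
              | P in U].
Proof.
set supinf := ereal_sup _; set infsup := ereal_inf _.
set maxinf := (X in _ /\ X = _); set infmax := ereal_inf _.
have sd_history d : history_policies R S A (sd_policy R d).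
  move=> h s; split=> [a|]; first by rewrite /sd_policy.
  rewrite (bigD1 (d s))//= big1 ?addr0 /sd_policy ?eqxx// => a /negbTE ads.
  by rewrite ads.
have maxinf_supinf : (maxinf <= supinf)%E.
  apply: bigmax_le => [|d _]; first exact: leNye.
  by apply: ereal_sup_ubound; exists (sd_policy R d).
have supinf_infsup : (supinf <= infsup)%E.
  apply: ge_ereal_sup => _ [pi hpi <-]; apply: le_ereal_inf_tmp => _ [P UP <-].
  apply: (@le_trans _ _ (Ravg p0 pi P r)).
    by apply: ereal_inf_lbound; exists P.
  by apply: ereal_sup_ubound; exists pi.
have maxinf_infmax : (maxinf <= infmax)%E.
  apply: bigmax_le => [|d _]; first exact: leNye.
  apply: le_ereal_inf_tmp => _ [P UP <-].
  apply: le_trans (le_bigmax _ _ d).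
  by apply: ereal_inf_lbound; exists P.
have infmax_infsup : (infmax <= infsup)%E.
  apply: le_ereal_inf_tmp => _ [P UP <-].
  apply: (@le_trans _ _ (\big[maxe/-oo%E]_(d : {ffun S -> A})
                     Ravg p0 (sd_policy R d) P r)).
    by apply: ereal_inf_lbound; exists P.
  apply: bigmax_le => [|d _]; first exact: leNye.
  by apply: ereal_sup_ubound; exists (sd_policy R d).
(* [maxinf] is the least and [infsup] the greatest of the four values, so this one inequality makes
   all of them equal. *)
suff infsup_maxinf : (infsup <= maxinf)%E.
  split; apply/eqP; rewrite eq_le.
    by rewrite supinf_infsup (le_trans infsup_maxinf).
  by rewrite maxinf_infmax (le_trans infmax_infsup).
rewrite leNgt; apply/negP => lt_maxinf.
(* Finitely many near-minimizers, one for each stationary deterministic policy,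
   suffice for the adversary: by rectangularity it can recombine their rows. *)
have /choice[Pd PdP] (d : {ffun S -> A}) : exists P, U P /\
    (Ravg p0 (sd_policy R d) P r < infsup)%E.
  have /ereal_inf_lt[_ [P UP <-] ltP] :
      (ereal_inf [set Ravg p0 (sd_policy R d) P r | P in U] < infsup)%E.
    by apply: le_lt_trans lt_maxinf; exact: le_bigmax.
  by exists P.
have [Usa Usa_simplex UE] := U_rect.
have UdP d s a : Usa s a (Pd d (s, a)).
  by have [] := PdP d; rewrite UE => + _; apply.
have Pd_simplex d sa : simplex R S (Pd d sa).
  by case: sa => s a; exact/Usa_simplex/UdP.
pose d0 : {ffun S -> A} := [ffun=> point].
(* The minimizer's moves are the policies themselves: move [b] at [(s, a)] selects that row of
   [Pd b]. *)
have [g [d [sigma [gsup gsub pot]]]] :=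
  mean_payoff_saddle (point : A) d0 r Pd_simplex.
pose Ps : transitions R S A := fun sa => Pd (sigma sa) sa.
have UPs : U Ps by rewrite UE => s a; exact: UdP.
have Ps_simplex sa : simplex R S (Ps sa) by exact: Pd_simplex.
have : (infsup <= (\sum_s p0 s * g s)%:E)%E.
  apply: (@le_trans _ _ (ereal_sup [set Ravg p0 pi Ps r
                             | pi in history_policies R S A])).
    by apply: ereal_inf_lbound; exists Ps.
  apply: ge_ereal_sup => _ [pi hpi <-]; apply: Ravg_le => //.
    by move=> _ s a _; exact: gsup.
  by move=> e /pot[f [fP _]]; exists f => _ s a _; exact: fP.
(* For the contradiction, let the saddle policy [d] face its own kernel [Pd d], the constant reply
   [d] in the game: it earns at least the average of [g], yet [Pd d] keeps it below [infsup]. *)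
rewrite leNgt => /negP; apply.
apply: le_lt_trans (PdP d).2.
have sdP (h : seq (S * A)) s a : sd_policy R d h s a != 0 -> a = d s.
  by apply: contraNeq => /negbTE ads; rewrite /sd_policy ads.
apply: Ravg_ge => //.
  by move=> h s a /sdP ->; exact: gsub.
by move=> e /pot[f [_ fP]]; exists f => h s a /sdP ->; exact: fP.
Qed.
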